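(* Let $d\ge 2$, $\eta>0$, let $u_1,\ldots,u_n\in S^{d-1}$ be the initial opinions of $n$ agents, and let $k\in\{0,1,\ldots,n\}$. For any $v^*\in S^{d-1}$, the following are equivalent: (i) there exists an infinite sequence of interventions $v^{(1)},v^{(2)},\ldots\in S^{d-1}$ such that, for at least $k$ indices $i\in\{1,\ldots,n\}$, the opinions defined by $u_i^{(1)}=u_i$ and $u_i^{(t+1)}=f(u_i^{(t)},v^{(t)})$ satisfy $\lim_{t\to\infty}\|u_i^{(t)}-v^*\|=0$; (ii) there exists an open hemisphere containing at least $k$ of the opinions $u_1,\ldots,u_n$.
   Context: $S^{d-1}$ is the Euclidean unit sphere in $\mathbb{R}^d$, $\langle\cdot,\cdot\rangle$ the standard inner product, $\|\cdot\|$ the Euclidean norm. For a fixed parameter $\eta>0$, applying an intervention $v\in S^{d-1}$ to an opinion $u\in S^{d-1}$ gives the updated opinion $f(u,v)=w/\|w\|$, where $w=u+\eta\langle u,v\rangle v$ (here $\|w\|\ge 1$). At each time step the same intervention is applied to all opinions. An open hemisphere is the intersection of $S^{d-1}$ with a homogeneous open halfspace $\{x\in\mathbb{R}^d:\langle x,a\rangle>0\}$ for some $a\in\mathbb{R}^d$. Opinions are counted by agent, i.e. with multiplicity in the list $u_1,\ldots,u_n$. *)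

(* Defs.v *)
From HB Require Import structures.
From mathcomp Require Import all_boot all_order all_algebra.
From mathcomp Require Import all_classical all_reals all_analysis.

Set Implicit Arguments.
Unset Strict Implicit.
Unset Printing Implicit Defensive.

Import Order.TTheory GRing.Theory Num.Theory.
Import numFieldNormedType.Exports.
Local Open Scope classical_set_scope.
Local Open Scope ring_scope.

Definition inner (R : realType) (d : nat) (u v : 'rV[R]_d) : R :=
  \sum_(i < d) u 0 i * v 0 i.

(* The norm `|u| that MathComp-Analysis puts on 'rV[R]_d is the sup norm. *)
Definition enorm (R : realType) (d : nat) (u : 'rV[R]_d) : R :=
  Num.sqrt (inner u u).

Definition usphere (R : realType) (d : nat) : set 'rV[R]_d :=
  [set u | enorm u = 1].
Arguments usphere : clear implicits.

Definition update_dir (R : realType) (d : nat) (eta : R) (u v : 'rV[R]_d) :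
    'rV[R]_d :=
  u + (eta * inner u v) *: v.

Definition update (R : realType) (d : nat) (eta : R) (u v : 'rV[R]_d) :
    'rV[R]_d :=
  (enorm (update_dir eta u v))^-1 *: update_dir eta u v.

(* Time is counted from 0: [v t] and [opinion eta v u t] are v^(t+1) and
   u^(t+1) when time is counted from 1. *)
Fixpoint opinion (R : realType) (d : nat) (eta : R) (v : nat -> 'rV[R]_d)
    (u : 'rV[R]_d) (t : nat) : 'rV[R]_d :=
  if t is t'.+1 then update eta (opinion eta v u t') (v t') else u.

(* [a] may be 0, in which case the hemisphere is empty. *)
Definition open_hemisphere (R : realType) (d : nat) (H : set 'rV[R]_d) : Prop :=
  exists a : 'rV[R]_d, H = usphere R d `&` [set x | 0 < inner x a].

Definition at_least (n k : nat) (P : 'I_n -> Prop) : Prop :=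
  exists2 I : {set 'I_n}, (k <= #|I|)%N & forall i, i \in I -> P i.

(* Main.v *)
Require Import Defs.
From HB Require Import structures.
From mathcomp Require Import all_boot all_order all_algebra.
From mathcomp Require Import all_classical all_reals all_analysis.
From mathcomp Require Import ring lra.

Set Implicit Arguments.
Unset Strict Implicit.
Unset Printing Implicit Defensive.

Import Order.TTheory GRing.Theory Num.Theory.
Import numFieldNormedType.Exports.
Local Open Scope classical_set_scope.
Local Open Scope ring_scope.

(** An intervention [v] acts, up to normalisation, by the symmetric matrix
    [A_v = I + eta v v^T], so after [t] steps the sign of the inner product of
    an opinion [u] with [b] is that of [<u, A_1 ... A_t b>].  If the opinions
    in question converge to [vstar], then taking [b = vstar] exhibits a
    halfspace containing all of them.

    Conversely, applying [vstar] forever drives every opinion with positive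
    inner product with [vstar] to [vstar], so it suffices to find
    [v_1, ..., v_N] such that [A_1 ... A_N vstar] lies in the open cone of
    normals of halfspaces containing the given opinions.  By duality this is
    the problem of steering the single vector [vstar] into that cone.
    Repeating the intervention [z] steers [b] arbitrarily close to the ray of
    [z] whenever [<b, z> > 0]; as [d >= 2], two such hops suffice to approach
    any vector which is not a multiple of [vstar], and the cone, being open,
    contains one as soon as it is nonempty. *)

(** * The Euclidean inner product and the unit sphere *)

Section Inner.
Variables (R : realType) (d : nat).
Implicit Types (u v w : 'rV[R]_d) (c : R).

Lemma innerC u v : inner u v = inner v u.
Proof. by apply: eq_bigr => i _; rewrite mulrC. Qed.

Lemma innerDl u v w : inner (u + v) w = inner u w + inner v w.
Proof. by rewrite -big_split; apply: eq_bigr => i _; rewrite !mxE mulrDl. Qed.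

Lemma innerZl c u v : inner (c *: u) v = c * inner u v.
Proof. by rewrite mulr_sumr; apply: eq_bigr => i _; rewrite !mxE mulrA. Qed.

Lemma inner0l v : inner 0 v = 0.
Proof. by rewrite -(mul0r (inner 0 v)) -innerZl scale0r. Qed.

Lemma innerDr u v w : inner w (u + v) = inner w u + inner w v.
Proof. by rewrite innerC innerDl !(innerC w). Qed.

Lemma innerZr c u v : inner v (c *: u) = c * inner v u.
Proof. by rewrite innerC innerZl (innerC v). Qed.

Lemma innerNl u v : inner (- u) v = - inner u v.
Proof. by rewrite -scaleN1r innerZl mulN1r. Qed.

Lemma innerNr u v : inner u (- v) = - inner u v.
Proof. by rewrite innerC innerNl innerC. Qed.

Definition innerE := (innerDl, innerDr, innerNl, innerNr, innerZl, innerZr).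

Lemma inner_ge0 u : 0 <= inner u u.
Proof. by apply: sumr_ge0 => i _; rewrite -expr2 sqr_ge0. Qed.

Lemma inner_gt0 u : (0 < inner u u) = (u != 0).
Proof.
rewrite lt0r inner_ge0 andbT; congr (~~ _); apply/eqP/eqP => [u0|->].
  apply/rowP => i; rewrite mxE; apply/eqP; rewrite -sqrf_eq0 expr2.
  move/eqP: u0; rewrite psumr_eq0 => [/allP/(_ i)|j _].
    by rewrite mem_index_enum => /(_ isT).
  by rewrite -expr2 sqr_ge0.
by rewrite inner0l.
Qed.

Lemma sqr_enorm u : enorm u ^+ 2 = inner u u.
Proof. by rewrite sqr_sqrtr ?inner_ge0. Qed.

Lemma enorm_gt0 u : (0 < enorm u) = (u != 0).
Proof. by rewrite sqrtr_gt0 inner_gt0. Qed.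

Lemma usphereP u : usphere R d u <-> inner u u = 1.
Proof.
split=> [h|h]; first by rewrite -sqr_enorm (h : enorm u = 1) expr1n.
by rewrite /usphere /= /enorm h sqrtr1.
Qed.

Lemma usphere_normalize u : u != 0 -> usphere R d ((enorm u)^-1 *: u).
Proof.
move=> u0; apply/usphereP; rewrite !innerE -sqr_enorm.
have : enorm u != 0 by rewrite gt_eqF ?enorm_gt0.
by move=> h; field.
Qed.

Lemma inner_usphere_le1 u v :
  usphere R d u -> usphere R d v -> inner u v <= 1.
Proof.
move=> /usphereP uu /usphereP vv.
have := inner_ge0 (u - v); rewrite !innerE uu vv (innerC v u); lra.
Qed.

(** The column [u^T] has rank at most 1, so its left kernel has dimension at least [d - 1]. *)
Lemma exists_orthogonal u : (2 <= d)%N -> exists2 e, e != 0 & inner e u = 0.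
Proof.
move=> d2; have : kermx u^T != 0.
  rewrite -mxrank_eq0 mxrank_ker -lt0n subn_gt0.
  by rewrite (leq_ltn_trans _ d2) // mxrank_tr rank_leq_row.
case/rowV0Pn => e /sub_kermxP eu e0; exists e => //.
transitivity ((e *m u^T) 0 0); last by rewrite eu mxE.
by rewrite mxE; apply: eq_bigr => i _; rewrite mxE.
Qed.

End Inner.

(** * Strict inequalities under small perturbations; Bernoulli's inequality *)

Section Perturbation.
Variable R : realType.

Lemma pos_perturb (x y : R) : 0 < x ->
  exists2 e, 0 < e & forall c, 0 < c < e -> 0 < x + c * y.
Proof.
move=> x0; exists (x / (1 + `|y|)).
  by rewrite divr_gt0 // ltr_pwDl.
have D0 : 0 < 1 + `|y| by rewrite ltr_pwDl.
move=> c /andP[c0]; rewrite ltr_pdivlMr // => cx.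
have := ler_norm (- y); rewrite normrN => h.
have : c * - y <= c * `|y| by rewrite ler_pM2l.
by lra.
Qed.

Lemma pos_perturb_fin (I : finType) (A : {set I}) (f g : I -> R) :
    (forall i, i \in A -> 0 < f i) ->
  exists2 e, 0 < e &
    forall c, 0 < c < e -> forall i, i \in A -> 0 < f i + c * g i.
Proof.
move=> f0.
have h i : exists e, 0 < e /\
    (i \in A -> forall c, 0 < c < e -> 0 < f i + c * g i).
  have [iA|_] := boolP (i \in A); last by exists 1.
  by have [e e0 he] := pos_perturb (g i) (f0 _ iA); exists e.
have [F hF] := choice h.
(* The default [1] keeps the minimum positive even when [I] is empty. *)
exists (\big[Order.min/1]_i F i).
  by apply: lt_bigmin => // i _; have [] := hF i.
move=> c /andP[c0 ce] i iA; apply: (hF i).2 => //; rewrite c0 /=.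
exact: lt_le_trans ce (bigmin_le_cond _ _ _).
Qed.

Lemma bernoulli_ge (x : R) m : 0 <= x -> 1 + m%:R * x <= (1 + x) ^+ m.
Proof.
move=> x0; elim: m => [|m IH]; first by rewrite mul0r addr0 expr0.
have mx : 0 <= m%:R * x by rewrite mulr_ge0.
have h : (1 + m%:R * x) * (1 + x) <= (1 + x) ^+ m * (1 + x).
  by rewrite ler_wpM2r // addr_ge0.
rewrite exprSr -natr1; nra.
Qed.

End Perturbation.

(** * Dynamics under interventions and the dual steering problem *)

Section Dynamics.
Variables (R : realType) (d : nat) (eta : R).
Hypothesis eta0 : 0 < eta.
Implicit Types (a b u v x z : 'rV[R]_d).

Lemma inner_update_dir u v b :
  inner (update_dir eta u v) b = inner u (update_dir eta b v).
Proof. by rewrite /update_dir !innerE (innerC v b); ring. Qed.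

Lemma inner_update_gt0 u v b :
  (0 < inner (update eta u v) b) = (0 < inner u (update_dir eta b v)).
Proof.
rewrite /update innerZl -inner_update_dir.
(* If the direction vanishes, both inequalities read [0 < 0]. *)
have [w0|w0] := eqVneq (update_dir eta u v) 0.
  by rewrite w0 inner0l mulr0 ltxx.
by rewrite pmulr_rgt0 // invr_gt0 enorm_gt0.
Qed.

Lemma opinion_inner_gt0 (v : nat -> 'rV[R]_d) t b :
  exists a, forall u, 0 < inner (opinion eta v u t) b -> 0 < inner u a.
Proof.
elim: t b => [|t IH] b; first by exists b.
have [a ha] := IH (update_dir eta b (v t)); exists a => u /=.
by rewrite inner_update_gt0 => /ha.
Qed.

Lemma inner_update_dir_self u v : usphere R d u -> usphere R d v ->
  inner (update_dir eta u v) (update_dir eta u v) =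
  1 + (eta ^+ 2 + 2 * eta) * inner u v ^+ 2.
Proof.
move=> /usphereP uu /usphereP vv.
by rewrite /update_dir !innerE uu vv (innerC v u); ring.
Qed.

Lemma update_dir_neq0 u v : usphere R d u -> usphere R d v ->
  update_dir eta u v != 0.
Proof.
move=> hu hv; rewrite -inner_gt0 inner_update_dir_self // ltr_pwDl //.
by rewrite mulr_ge0 ?sqr_ge0 // addr_ge0 ?sqr_ge0 // mulr_ge0 // ltW.
Qed.

Lemma usphere_update u v : usphere R d u -> usphere R d v ->
  usphere R d (update eta u v).
Proof. by move=> hu hv; exact/usphere_normalize/update_dir_neq0. Qed.

Lemma usphere_opinion (v : nat -> 'rV[R]_d) u t :
    usphere R d u -> (forall s, usphere R d (v s)) ->
  usphere R d (opinion eta v u t).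
Proof. by move=> hu hv; elim: t => //= t IH; exact: usphere_update. Qed.

Lemma opinion_add (v : nat -> 'rV[R]_d) u s t :
  opinion eta v u (t + s) =
  opinion eta (fun r => v (r + s)%N) (opinion eta v u s) t.
Proof. by elim: t => //= t ->. Qed.

Lemma eq_opinion (v w : nat -> 'rV[R]_d) u t :
    (forall s, (s < t)%N -> v s = w s) ->
  opinion eta v u t = opinion eta w u t.
Proof.
elim: t => //= t IH h; rewrite h // IH // => s st.
by rewrite h // (ltn_trans st).
Qed.

(** Before normalisation, a step multiplies the component along [x] by [1 + eta] and fixes the
    orthogonal one. Hence the squared tangent of the angle to [x], that is
    [(1 - beta ^+ 2) / beta ^+ 2], is divided by [(1 + eta) ^+ 2]; the identity states this with
    denominators cleared. *)
Lemma opinion_cst_invariant u x t :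
    usphere R d u -> usphere R d x -> 0 < inner u x ->
  let beta := inner (opinion eta (fun=> x) u t) x in
  0 < beta /\
  (1 - beta ^+ 2) * (1 + eta) ^+ t ^+ 2 * inner u x ^+ 2 =
  (1 - inner u x ^+ 2) * beta ^+ 2.
Proof.
move=> hu hx ux /=; elim: t => [|t [IH0 IH]] /=; first by split=> //; ring.
set y := opinion eta (fun=> x) u t in IH0 IH *.
have hy : usphere R d y by exact: usphere_opinion.
have N0 : enorm (update_dir eta y x) != 0.
  by rewrite gt_eqF // enorm_gt0 update_dir_neq0.
have N2 := sqr_enorm (update_dir eta y x).
rewrite inner_update_dir_self // in N2.
have xx : inner x x = 1 by exact/usphereP.
have -> : inner (update eta y x) x =
    (1 + eta) * inner y x / enorm (update_dir eta y x).
  by rewrite /update /update_dir !innerE xx; field.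
split.
  by rewrite divr_gt0 ?enorm_gt0 ?update_dir_neq0 // mulr_gt0 // addr_gt0.
move: IH N2 N0; set N := enorm _; set beta := inner y x.
set q := (1 + eta) ^+ t; set K := inner u x => IH N2 N0.
rewrite (exprSr _ t) -/q expr_div_n.
have -> : 1 - ((1 + eta) * beta) ^+ 2 / N ^+ 2 = (1 - beta ^+ 2) / N ^+ 2.
  rewrite -[X in X - _](@divff _ (N ^+ 2)) ?sqrf_eq0 // -mulrBl.
  by congr (_ / _); rewrite N2; ring.
transitivity ((1 - beta ^+ 2) * q ^+ 2 * K ^+ 2 * (1 + eta) ^+ 2 / N ^+ 2).
  by field.
by rewrite IH; field.
Qed.

Lemma opinion_cst_cvg u x :
    usphere R d u -> usphere R d x -> 0 < inner u x ->
  enorm (opinion eta (fun=> x) u t - x) @[t --> \oo] --> (0 : R).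
Proof.
move=> hu hx ux; pose K := 2 / inner u x ^+ 2.
have q1 : 1 < 1 + eta by rewrite ltrDl.
have q0 : 0 < 1 + eta by exact: lt_trans q1.
rewrite -[X in _ --> X](@sqrtr0 R); apply: continuous_cvg.
  exact: sqrt_continuous.
apply: (@squeeze_cvgr _ _ _ _ (fun=> 0) (geometric K (1 + eta)^-1)).
- near=> t; rewrite inner_ge0 /=.
  have [b0 hb] := opinion_cst_invariant t hu hx ux.
  have hy : usphere R d (opinion eta (fun=> x) u t) by exact: usphere_opinion.
  have b1 := inner_usphere_le1 hy hx.
  rewrite !innerE ((usphereP _).1 hy) ((usphereP _).1 hx) (innerC x).
  move: b0 b1 hb; set beta := inner (opinion _ _ _ _) x => b0 b1 hb.
  have Q1 : 1 <= (1 + eta) ^+ t by rewrite exprn_ege1 // ltW.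
  have k0 : 0 < inner u x ^+ 2 by rewrite exprn_gt0.
  rewrite /geometric /= exprVn /K -mulrA -invfM.
  rewrite ler_pdivlMr ?mulr_gt0 ?exprn_gt0 //.
  move: Q1 k0 hb; set Q := (1 + eta) ^+ t; set k := inner u x ^+ 2.
  move=> Q1 k0 hb.
  (* The squared distance is [2 * (1 - beta)]. The invariant turns the right-hand side into
     [(1 - k) * beta ^+ 2], which is at most 1, so the distance squared is at most [2 / (k * Q)]. *)
  have h1 : (1 - beta) * (k * Q) <= (1 - beta ^+ 2) * (k * Q ^+ 2).
    apply: ler_pM; first by lra.
    - by rewrite mulr_ge0 //; lra.
    - by nra.
    - by rewrite ler_pM2l //; nra.
  have h2 : (1 - k) * beta ^+ 2 <= 1 by nra.
  nra.
- exact: cvg_cst.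
- by apply: cvg_geometric; rewrite ger0_norm ?invr_ge0 ?ltW // invf_lt1.
Unshelve. all: by end_near.
Qed.

(** Records only the effect on signs of [b] being a positive multiple of some [A_1 ... A_N x]. *)
Definition steerable x b := exists N (v : nat -> 'rV[R]_d),
  (forall t, usphere R d (v t)) /\
  forall u, 0 < inner u b -> 0 < inner (opinion eta v u N) x.

Lemma steerable_refl x : usphere R d x -> steerable x x.
Proof. by move=> hx; exists 0%N, (fun=> x). Qed.

Lemma steerable_update_dir x b v :
  usphere R d v -> steerable x b -> steerable x (update_dir eta b v).
Proof.
move=> hv [N [w [hw hN]]].
(* The dual product reverses the order: the last factor applied to [b] is the first intervention on
   opinions. *)
exists N.+1, (fun t => if t is t'.+1 then w t' else v).
split=> [[|t] //|u ub].
rewrite -[N.+1]addn1 opinion_add (@eq_opinion _ w).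
  by apply: hN; rewrite /= inner_update_gt0.
by move=> s _; rewrite addn1.
Qed.

Lemma steerableZ x b c : 0 < c -> steerable x b -> steerable x (c *: b).
Proof.
move=> c0 [N [v [hv hN]]]; exists N, v; split=> // u.
by rewrite innerZr pmulr_rgt0 //; exact: hN.
Qed.

(** The vector is [A_v^m b]: [A_v] has eigenvalue [1 + eta] on [v] and 1 on its orthogonal
    complement. *)
Lemma steerable_iter x b v m : usphere R d v -> steerable x b ->
  steerable x (b + (((1 + eta) ^+ m - 1) * inner b v) *: v).
Proof.
move=> hv hb; elim: m => [|m IH].
  by rewrite expr0 subrr mul0r scale0r addr0.
have := steerable_update_dir hv IH; congr steerable.
rewrite /update_dir -addrA -scalerDl; congr (_ + _ *: _).
by rewrite innerDl innerZl ((usphereP _).1 hv) exprSr; ring.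
Qed.

Lemma steerable_approach x b z e : 0 < e -> 0 < inner b z -> steerable x b ->
  exists2 c, 0 < c < e & steerable x (z + c *: b).
Proof.
move=> e0 bz hb.
have z0 : z != 0.
  by apply: contraTneq bz => ->; rewrite innerC inner0l ltxx.
have N0 : 0 < enorm z by rewrite enorm_gt0.
pose K := enorm z ^+ 2 / inner b z.
have K0 : 0 < K by rewrite divr_gt0 // exprn_gt0.
have [m hm] : exists m : nat, K / (e * eta) < m%:R.
  by eexists; apply: archi_boundP; rewrite ltW // divr_gt0 // mulr_gt0.
(* After [m] uses of the normalised [z], rescaling by [K / q] makes the coefficient of [z] equal to
   1 and leaves [K / q] on [b]; this bound makes that less than [e]. *)
have hq : K / e < (1 + eta) ^+ m - 1.
  rewrite ltrBrDl; apply: lt_le_trans (bernoulli_ge m (ltW eta0)).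
  by rewrite ltrD2l ltr_pdivrMr // -mulrA (mulrC eta) -ltr_pdivrMr ?mulr_gt0.
have q0 : 0 < (1 + eta) ^+ m - 1.
  by apply: lt_trans hq; rewrite divr_gt0.
set q := (1 + eta) ^+ m - 1 in hq q0.
exists (K / q).
  by rewrite divr_gt0 //= ltr_pdivrMr // mulrC -ltr_pdivrMr.
have hz := usphere_normalize z0.
have Kq : 0 < K / q by rewrite divr_gt0.
have := steerableZ Kq (steerable_iter m hz hb).
congr steerable; rewrite scalerDr addrC !scalerA innerZr -/q /K.
rewrite -[X in _ = X + _]scale1r; congr (_ *: _ + _).
by field; rewrite !gt_eqF.
Qed.

Lemma steerable_hop (I : finType) (A : {set I}) (u : I -> 'rV[R]_d) x a b :
    (forall i, i \in A -> 0 < inner (u i) a) ->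
    0 < inner b a -> steerable x b ->
  exists2 b', steerable x b' & forall i, i \in A -> 0 < inner (u i) b'.
Proof.
move=> ha ba hb.
have [e e0 he] := pos_perturb_fin (fun i => inner (u i) b) ha.
have [c hc hcb] := steerable_approach e0 ba hb.
by exists (a + c *: b) => // i iA; rewrite !innerE; exact: he.
Qed.

(* The hops are [x -> p + delta x -> a], where [p] is the component of [a]
   orthogonal to [x]. *)
Lemma steerable_cone_generic (I : finType) (A : {set I}) (u : I -> 'rV[R]_d)
    x a :
    usphere R d x -> a - inner a x *: x != 0 ->
    (forall i, i \in A -> 0 < inner (u i) a) ->
  exists2 b, steerable x b & forall i, i \in A -> 0 < inner (u i) b.
Proof.
move=> hx; move pE : (a - _) => p p0 ha; have xx := (usphereP _).1 hx.
have px : inner p x = 0 by rewrite -pE !innerE xx; ring.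
have pp : 0 < inner p a.
  have <- : inner p (a - inner a x *: x) = inner p a.
    by rewrite !innerE px mulr0 subr0.
  by rewrite pE inner_gt0.
have [e e0 he] := pos_perturb (inner x a) pp.
(* The multiple of [x] makes [inner x z] positive, as the first hop requires, and is small enough to
   keep [inner z a] positive for the second. *)
pose z := p + (e / 2) *: x.
have za : 0 < inner z a by rewrite !innerE he // divr_gt0 //=; lra.
have xz : 0 < inner x z.
  by rewrite !innerE xx innerC px add0r mulr1 divr_gt0.
have [e' e'0 he'] := pos_perturb (inner x a) za.
have [c hc hcz] := steerable_approach e'0 xz (steerable_refl hx).
by apply: (steerable_hop ha _ hcz); rewrite innerDl innerZl he'.
Qed.

Lemma steerable_cone (I : finType) (A : {set I}) (u : I -> 'rV[R]_d) x a :
    (2 <= d)%N -> usphere R d x ->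
    (forall i, i \in A -> 0 < inner (u i) a) ->
  exists2 b, steerable x b & forall i, i \in A -> 0 < inner (u i) b.
Proof.
move=> d2 hx ha; have [p0|p0] := eqVneq (a - inner a x *: x) 0; last first.
  exact: steerable_cone_generic p0 ha.
(* Here [a] is a multiple of [x]; a small shift along [w] stays in the open cone and has nonzero
   component orthogonal to [x]. *)
have [w w0 wx] := exists_orthogonal x d2.
have [e e0 he] := pos_perturb_fin (fun i => inner (u i) w) ha.
have e2 : 0 < e / 2 by rewrite divr_gt0.
apply: (@steerable_cone_generic _ _ _ _ (a + (e / 2) *: w)) => //.
  rewrite innerDl innerZl wx mulr0 addr0 addrAC p0 add0r.
  by rewrite scaler_eq0 negb_or gt_eqF.
by move=> i iA; rewrite !innerE he // e2 /=; lra.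
Qed.

Lemma steerable_cvg x b : usphere R d x -> steerable x b ->
  exists2 v : nat -> 'rV[R]_d, forall t, usphere R d (v t) &
    forall u, usphere R d u -> 0 < inner u b ->
      enorm (opinion eta v u t - x) @[t --> \oo] --> (0 : R).
Proof.
move=> hx [N [v [hv hN]]].
pose w t := if (t < N)%N then v t else x.
exists w => [t|u hu ub]; first by rewrite /w; case: ifP.
rewrite -(cvg_shiftn N) /=.
have wN : opinion eta w u N = opinion eta v u N.
  by apply: eq_opinion => s sN; rewrite /w sN.
under eq_cvg => t.
  rewrite opinion_add wN (@eq_opinion _ (fun=> x)); last first.
    by move=> s _; rewrite /w ltnNge leq_addl.
  over.
by apply: opinion_cst_cvg; [exact: usphere_opinion| |exact: hN].
Qed.

End Dynamics.

Theorem theorem4p1 (R : realType) (d n k : nat) (eta : R)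
    (u : 'I_n -> 'rV[R]_d) (vstar : 'rV[R]_d)
    (hd : (2 <= d)%N) (heta : 0 < eta)
    (hu : forall i, usphere R d (u i)) (hk : (k <= n)%N)
    (hvstar : usphere R d vstar) :
  (exists2 v : nat -> 'rV[R]_d,
      forall t, usphere R d (v t) &
      at_least k (fun i : 'I_n =>
        enorm (opinion eta v (u i) t - vstar) @[t --> \oo] --> (0 : R)))
  <->
  (exists2 H : set 'rV[R]_d,
      open_hemisphere H & at_least k (fun i : 'I_n => H (u i))).
Proof.
split=> [[v hv [A kA hA]]|[_ [a ->] [A kA hA]]].
  have : \forall t \near \oo, forall i, i \in A ->
      0 < inner (opinion eta v (u i) t) vstar.
    apply: filter_forall => i; have [iA|_] := boolP (i \in A); last first.
      by near=> t.
    (* For unit vectors the squared distance is 2 minus twice the inner product, so distance below 1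
       forces a positive inner product. *)
    have /cvgr_lt/(_ _ ltr01) := hA _ iA; apply: filterS => t ht _.
    have hy := usphere_opinion heta t (hu i) hv.
    have : enorm (opinion eta v (u i) t - vstar) ^+ 2 < 1.
      by rewrite expr_lt1 // sqrtr_ge0.
    rewrite sqr_enorm !innerE ((usphereP _).1 hy) ((usphereP _).1 hvstar).
    rewrite (innerC vstar); lra.
  case=> t _ /(_ t (leqnn t)) ht.
  have [a ha] := opinion_inner_gt0 eta v t vstar.
  exists (usphere R d `&` [set x | 0 < inner x a]); first by exists a.
  by exists A => // i iA; split=> //=; apply: ha; exact: ht.
have [b hb hub] := steerable_cone heta hd hvstar (fun i iA => (hA i iA).2).
have [v hv hcvg] := steerable_cvg heta hvstar hb.
by exists v => //; exists A => // i iA; apply: hcvg => //; exact: hub.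
Unshelve. all: by end_near.
Qed.
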